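(* Let $r\ge1$, let $\boldsymbol{\mu}=(\mu_1,\dots,\mu_r)$ be a system of (possibly complex) measures on $\mathbb{R}$ with all moments finite, let $\ell\ge1$, and let $\boldsymbol{n}_1,\dots,\boldsymbol{n}_\ell\in\mathbb{N}^r$ be multi-indices such that for every $s=1,\dots,\ell-1$ one has $\boldsymbol{n}_{s+1}=\boldsymbol{n}_s+\boldsymbol{e}_{j_s}$ for some $j_s\in\{1,\dots,r\}$. Suppose that each $\boldsymbol{n}_s$, $s=1,\dots,\ell$, is normal for $\boldsymbol{\mu}$, and let $P_{\boldsymbol{n}_s}$ be the corresponding type II multiple orthogonal polynomials. Then $$\{z_0\in\mathbb{C}: W(P_{\boldsymbol{n}_1},\dots,P_{\boldsymbol{n}_\ell};z_0)=0\}=\{z_0\in\mathbb{C}:\boldsymbol{n}_1\text{ is not normal for }((x-z_0)^\ell\mu_1,\dots,(x-z_0)^\ell\mu_r)\}.$$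
   Context: $\mathbb{N}=\{0,1,2,\dots\}$; $|\boldsymbol{n}|=n_1+\dots+n_r$ for $\boldsymbol{n}=(n_1,\dots,n_r)$; $\boldsymbol{e}_j$ is the $j$-th standard unit vector. A type II multiple orthogonal polynomial for a system $\boldsymbol{\mu}=(\mu_1,\dots,\mu_r)$ of (possibly complex) measures on $\mathbb{R}$ with finite moments, at $\boldsymbol{n}\in\mathbb{N}^r$, is a monic polynomial $P_{\boldsymbol{n}}$ of exact degree $|\boldsymbol{n}|$ with $\int P_{\boldsymbol{n}}(x)x^k\,d\mu_i(x)=0$ for $k=0,\dots,n_i-1$, $i=1,\dots,r$. The index $\boldsymbol{n}$ is normal for $\boldsymbol{\mu}$ if such a $P_{\boldsymbol{n}}$ exists and is unique. Equivalently, the $|\boldsymbol{n}|\times|\boldsymbol{n}|$ matrix obtained by stacking, for $i=1,\dots,r$, the blocks $\big(\int x^{p+q}d\mu_i(x)\big)_{0\le p\le n_i-1,\,0\le q\le|\boldsymbol{n}|-1}$ has non-zero determinant (the empty determinant being $1$). $(x-z_0)^\ell\mu$ denotes the measure $\nu$ with $\int f\,d\nu=\int f(x)(x-z_0)^\ell\,d\mu(x)$. The Wronskian of polynomials $Q_1,\dots,Q_\ell$ is $W(Q_1,\dots,Q_\ell;x)=\det\big(Q_k^{(i-1)}(x)\big)_{1\le i,k\le\ell}$. *)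

(* Defs.v *)
From HB Require Import structures.
From mathcomp Require Import all_boot all_order all_algebra.
From mathcomp Require Import complex.
From mathcomp Require Import all_classical all_reals all_analysis.

Set Implicit Arguments.
Unset Strict Implicit.
Unset Printing Implicit Defensive.

Import Order.TTheory GRing.Theory Num.Theory.
Import numFieldNormedType.Exports.

Local Open Scope classical_set_scope.
Local Open Scope ring_scope.
Local Open Scope complex_scope.

Section charge_integral.
Context d (T : measurableType d) (R : realType).
Implicit Types (nu : {charge set T -> \bar R}) (f g : T -> R).

(* A chosen Hahn decomposition; the Jordan parts built from it do not depend on
   the choice (Hahn_decomposition_uniq). *)
Definition hahn_pos nu : set T := projT1 (cid (Hahn_decomposition nu)).

Definition hahn_neg nu : set T :=
  projT1 (cid (projT2 (cid (Hahn_decomposition nu)))).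

Lemma hahn_posneg nu : hahn_decomposition nu (hahn_pos nu) (hahn_neg nu).
Proof. exact: projT2 (cid (projT2 (cid (Hahn_decomposition nu)))). Qed.

Definition charge_integrable nu f : Prop :=
  (jordan_pos (hahn_posneg nu)).-integrable setT (EFin \o f) /\
  (jordan_neg (hahn_posneg nu)).-integrable setT (EFin \o f).

Definition charge_integral nu f : R :=
  Rintegral (jordan_pos (hahn_posneg nu)) setT f -
  Rintegral (jordan_neg (hahn_posneg nu)) setT f.

(* The charge A |-> \int_A f dnu, i.e. f nu. *)
Definition charge_density nu f (h : charge_integrable nu f) :
    {charge set T -> \bar R} :=
  cadd (induced_charge h.1) (copp (induced_charge h.2)).

Lemma charge_integrable0 nu : charge_integrable nu (fun=> 0).
Proof. by split; exact: integrable0. Qed.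

Lemma charge_integrableZ nu a f :
  charge_integrable nu f -> charge_integrable nu (fun x => a * f x).
Proof.
move=> [hp hn]; split.
- exact: (integrableZl measurableT a hp).
- exact: (integrableZl measurableT a hn).
Qed.

Lemma charge_integrableD nu f g : charge_integrable nu f ->
  charge_integrable nu g -> charge_integrable nu (fun x => f x + g x).
Proof.
move=> [fp fn] [gp gn]; split.
- exact: (integrableD measurableT fp gp).
- exact: (integrableD measurableT fn gn).
Qed.

End charge_integral.

(* Since the total mass is one of the moments, a (positive, signed or complex)
   measure with finite moments is finite: its real and imaginary parts are
   charges in the sense of the library. *)
Record complex_measure (R : realType) := ComplexMeasure {
  re_part : {charge set (measurableTypeR R) -> \bar R} ;
  im_part : {charge set (measurableTypeR R) -> \bar R} }.

Section complex_measure_theory.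
Variable R : realType.
Implicit Types (mu : complex_measure R) (f g : R -> R[i]).

Definition cm_integrable mu f : Prop :=
  [/\ charge_integrable (re_part mu) (@complex.Re R \o f),
      charge_integrable (re_part mu) (@complex.Im R \o f),
      charge_integrable (im_part mu) (@complex.Re R \o f) &
      charge_integrable (im_part mu) (@complex.Im R \o f)].

Definition cm_integral mu f : R[i] :=
  (charge_integral (re_part mu) (@complex.Re R \o f) -
   charge_integral (im_part mu) (@complex.Im R \o f)) +i*
  (charge_integral (re_part mu) (@complex.Im R \o f) +
   charge_integral (im_part mu) (@complex.Re R \o f)).

Definition finite_moments mu : Prop :=
  forall k : nat, cm_integrable mu (fun x => x%:C ^+ k).

(* The complex measure f mu : A |-> \int_A f dmu. *)
Definition cm_density mu f (h : cm_integrable mu f) : complex_measure R :=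
  let: And4 rr ri ir ii := h in
  ComplexMeasure (cadd (charge_density rr) (copp (charge_density ii)))
                 (cadd (charge_density ri) (charge_density ir)).

Lemma cm_integrable0 mu : cm_integrable mu (fun=> 0).
Proof. by split; exact: charge_integrable0. Qed.

Lemma cm_integrableZ mu a f :
  cm_integrable mu f -> cm_integrable mu (fun x => a * f x).
Proof.
move=> [rr ri ir ii].
have reE : @complex.Re R \o (fun x => a * f x) =
    (fun x => complex.Re a * (@complex.Re R \o f) x + - complex.Im a * (@complex.Im R \o f) x).
  by apply/funext => x /=; rewrite mulNr; case: (a) (f x) => ? ? [].
have imE : @complex.Im R \o (fun x => a * f x) =
    (fun x => complex.Re a * (@complex.Im R \o f) x + complex.Im a * (@complex.Re R \o f) x).
  by apply/funext => x /=; case: (a) (f x) => ? ? [].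
by split; rewrite ?reE ?imE; apply: charge_integrableD;
  exact: charge_integrableZ.
Qed.

Lemma cm_integrableD mu f g : cm_integrable mu f -> cm_integrable mu g ->
  cm_integrable mu (fun x => f x + g x).
Proof.
move=> [frr fri fir fii] [grr gri gir gii].
have reE : @complex.Re R \o (fun x => f x + g x) = (fun x => (@complex.Re R \o f) x + (@complex.Re R \o g) x).
  by apply/funext => x /=; case: (f x) (g x) => ? ? [].
have imE : @complex.Im R \o (fun x => f x + g x) = (fun x => (@complex.Im R \o f) x + (@complex.Im R \o g) x).
  by apply/funext => x /=; case: (f x) (g x) => ? ? [].
by split; rewrite ?reE ?imE; exact: charge_integrableD.
Qed.

Lemma cm_integrable_horner mu (p : {poly R[i]}) :
  finite_moments mu -> cm_integrable mu (fun x => p.[x%:C]).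
Proof.
move=> hmu.
rewrite (_ : (fun x => _) = fun x => \sum_(k < size p) p`_k * x%:C ^+ k);
  last by apply/funext => x; rewrite horner_coef.
elim: (size p) => [|m IHm].
  by under eq_fun do rewrite big_ord0; exact: cm_integrable0.
under eq_fun do rewrite big_ord_recr/=.
by apply: cm_integrableD => //; exact: cm_integrableZ.
Qed.

Lemma cm_integrable_shift_pow mu (z0 : R[i]) (l : nat) :
  finite_moments mu -> cm_integrable mu (fun x => (x%:C - z0) ^+ l).
Proof.
move=> hmu; have := cm_integrable_horner (('X - z0%:P) ^+ l) hmu.
by under eq_fun do rewrite horner_exp hornerXsubC.
Qed.

(* The measure (x - z0)^l mu. *)
Definition shift_pow_measure mu (z0 : R[i]) (l : nat) (h : finite_moments mu) :
    complex_measure R :=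
  cm_density (cm_integrable_shift_pow z0 l h).

Definition mindex_norm (r : nat) (n : 'I_r -> nat) : nat := \sum_(i < r) n i.

Definition is_typeII_mop (r : nat) (mu : 'I_r -> complex_measure R)
    (n : 'I_r -> nat) (P : {poly R[i]}) : Prop :=
  [/\ P \is monic, size P = (mindex_norm n).+1 &
      forall (i : 'I_r) (k : nat), (k < n i)%N ->
        cm_integral (mu i) (fun x => P.[x%:C] * x%:C ^+ k) = 0].

Definition normal_index (r : nat) (mu : 'I_r -> complex_measure R)
    (n : 'I_r -> nat) : Prop :=
  exists! P : {poly R[i]}, is_typeII_mop mu n P.

End complex_measure_theory.

Definition wronskian (F : comNzRingType) (l : nat) (Q : 'I_l -> {poly F})
    (x : F) : F :=
  \det (\matrix_(i < l, k < l) ((Q k)^`(i)).[x]).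

(* Main.v *)
(** The polynomials of degree less than |n_1| + l that satisfy the orthogonality
    relations at n_1 are exactly the combinations of P_{n_1}, ..., P_{n_l}: their
    degrees are |n_1|, ..., |n_1| + l - 1, and what remains after cancelling the
    top l coefficients vanishes by normality of n_1. Normality of n_1 fails for
    (x - z0)^l mu iff some nonzero q of degree less than |n_1| makes
    q (x - z0)^l such a combination, i.e. iff some nontrivial combination of the
    P_{n_s} has a zero of order l at z0, i.e. iff the Wronskian matrix at z0 is
    singular. *)
From HB Require Import structures.
Require Import Defs.
From mathcomp Require Import all_boot all_order all_algebra.
From mathcomp Require Import complex.
From mathcomp Require Import all_classical all_reals all_analysis.
From mathcomp Require Import measurable_realfun ring lra.

Set Implicit Arguments.
Unset Strict Implicit.
Unset Printing Implicit Defensive.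

Import Order.TTheory GRing.Theory Num.Theory.

Local Open Scope classical_set_scope.
Local Open Scope ring_scope.

(** * Charges written as differences of measures, and additivity of the integral in the charge *)

Section measures.
Context (d : measure_display) (T : measurableType d) (R : realType).
Local Open Scope ereal_scope.

Lemma integrable_le_measure (m1 m2 : {measure set T -> \bar R}) (f : T -> \bar R) :
  (forall A, measurable A -> m1 A <= m2 A) ->
  m2.-integrable setT f -> m1.-integrable setT f.
Proof.
move=> m12 /integrableP[mf fin]; apply/integrableP; split=> //.
apply: le_lt_trans fin; apply: ge0_le_measure_integral => //.
exact: measurableT_comp.
Qed.

Lemma Rintegral_measure_add (m1 m2 : {measure set T -> \bar R}) (f : T -> R) :
  m1.-integrable setT (EFin \o f) -> m2.-integrable setT (EFin \o f) ->
  (\int[measure_add m1 m2]_x (f x) = \int[m1]_x (f x) + \int[m2]_x (f x))%R.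
Proof.
move=> f1 f2; rewrite /Rintegral integral_measure_add//.
  by rewrite fineD//; exact: integrable_fin_num.
Qed.

Lemma integrable_measure_add (m1 m2 : {measure set T -> \bar R}) (f : T -> \bar R) :
  m1.-integrable setT f -> m2.-integrable setT f ->
  (measure_add m1 m2).-integrable setT f.
Proof.
move=> /integrableP[mf f1] /integrableP[_ f2]; apply/integrableP; split=> //.
rewrite ge0_integral_measure_add//; last exact: measurableT_comp.
exact: lte_add_pinfty.
Qed.

Lemma chargeE (nu : {charge set T -> \bar R}) (P N : set T)
    (nuPN : hahn_decomposition nu P N) (A : set T) : measurable A ->
  nu A = jordan_pos nuPN A - jordan_neg nuPN A.
Proof. by move=> mA; rewrite (jordan_decomp nuPN)//= /cadd/= /cscale mulN1e. Qed.

(* The Jordan parts are dominated by any representation nu = a - b as a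
   difference of measures, and jordan_pos + b = a + jordan_neg. *)
Lemma charge_integral_diff (nu : {charge set T -> \bar R})
    (a b : {measure set T -> \bar R}) (f : T -> R) :
  (forall A, measurable A -> nu A + b A = a A) ->
  a.-integrable setT (EFin \o f) -> b.-integrable setT (EFin \o f) ->
  charge_integrable nu f /\
  charge_integral nu f = (\int[a]_x f x - \int[b]_x f x)%R.
Proof.
move=> nuba af bf; set h := hahn_posneg nu.
have [[mP posP] [mN negN] _ _] := h.
have nufin A : measurable A -> nu A \is a fin_num by move=> ?; exact: fin_num_measure.
have pa A : measurable A -> jordan_pos h A <= a A.
  move=> mA; rewrite jordan_posE cjordan_posE /crestr0 mem_set//= /crestr.
  have mAP := measurableI _ _ mA mP.
  apply: (@le_trans _ _ (a (A `&` hahn_pos nu))); last by rewrite le_measure ?inE//.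
  by rewrite -nuba// leeDl.
have nb A : measurable A -> jordan_neg h A <= b A.
  move=> mA; rewrite jordan_negE cjordan_negE /crestr0 mem_set//= /crestr.
  have mAN := measurableI _ _ mA mN.
  apply: (@le_trans _ _ (b (A `&` hahn_neg nu))); last by rewrite le_measure ?inE//.
  rewrite -[leLHS]add0e leeBlDr ?nufin// addeC nuba//.
have fp := integrable_le_measure pa af.
have fn := integrable_le_measure nb bf.
split=> //.
have : Rintegral (measure_add (jordan_pos h) b) setT f =
       Rintegral (measure_add a (jordan_neg h)) setT f.
  congr fine; apply: eq_measure_integral => A mA _.
  transitivity (measure_add (jordan_pos h) b A) => //.
  transitivity (measure_add a (jordan_neg h) A) => //.
  rewrite !measure_addE.
  by rewrite -nuba// (chargeE h)// addeAC subeK// fin_num_measure.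
move=> E; have := etrans (etrans (esym (Rintegral_measure_add fp bf)) E)
  (Rintegral_measure_add af fn).
by rewrite /charge_integral; lra.
Qed.

Let subeCA_fin (x y z t : \bar R) : x \is a fin_num -> y \is a fin_num ->
  z \is a fin_num -> t \is a fin_num -> x - y - (z - t) + (y + z) = x + t.
Proof.
move: x y z t => [x| |] [y| |] [z| |] [t| |]// _ _ _ _.
rewrite -!(EFinN, EFinD); congr EFin; ring.
Qed.

Let addeCA_fin (x y z t : \bar R) : x \is a fin_num -> y \is a fin_num ->
  z \is a fin_num -> t \is a fin_num -> x - y + (z - t) + (y + t) = x + z.
Proof.
move: x y z t => [x| |] [y| |] [z| |] [t| |]// _ _ _ _.
rewrite -!(EFinN, EFinD); congr EFin; ring.
Qed.

(** A sum or difference of two charges splits into four Jordan parts, two with each sign; merging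
    each pair into one measure brings this under [charge_integral_diff]. *)
Lemma charge_integral_diff2 (nu : {charge set T -> \bar R})
    (a1 a2 b1 b2 : {measure set T -> \bar R}) (f : T -> R) :
  a1.-integrable setT (EFin \o f) -> a2.-integrable setT (EFin \o f) ->
  b1.-integrable setT (EFin \o f) -> b2.-integrable setT (EFin \o f) ->
  (forall A, measurable A -> nu A + (b1 A + b2 A) = a1 A + a2 A) ->
  charge_integrable nu f /\
  charge_integral nu f =
    (\int[a1]_x f x + \int[a2]_x f x - (\int[b1]_x f x + \int[b2]_x f x))%R.
Proof.
move=> a1f a2f b1f b2f nuE.
rewrite -!Rintegral_measure_add//; apply: charge_integral_diff.
- by move=> A mA; have := nuE A mA; rewrite -!measure_addE.
- exact: integrable_measure_add.
- exact: integrable_measure_add.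
Qed.

Lemma charge_integral_addN (nu1 nu2 : {charge set T -> \bar R}) (f : T -> R) :
  charge_integrable nu1 f -> charge_integrable nu2 f ->
  charge_integrable (cadd nu1 (copp nu2)) f /\
  charge_integral (cadd nu1 (copp nu2)) f =
    (charge_integral nu1 f - charge_integral nu2 f)%R.
Proof.
move=> [p1 n1] [p2 n2].
(* The Jordan parts of [nu2] swap roles under negation: its negative part is counted on the positive
   side. *)
have [|i ->] := charge_integral_diff2 (nu := cadd nu1 (copp nu2)) p1 n2 n1 p2.
  move=> A mA; change (nu1 A - nu2 A + (
    jordan_neg (hahn_posneg nu1) A + jordan_pos (hahn_posneg nu2) A) =
    jordan_pos (hahn_posneg nu1) A + jordan_neg (hahn_posneg nu2) A).
  rewrite (chargeE (hahn_posneg nu1))// (chargeE (hahn_posneg nu2))//.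
  apply: subeCA_fin; exact: fin_num_measure.
by split=> //; rewrite /charge_integral; lra.
Qed.

Lemma charge_integral_add (nu1 nu2 : {charge set T -> \bar R}) (f : T -> R) :
  charge_integrable nu1 f -> charge_integrable nu2 f ->
  charge_integrable (cadd nu1 nu2) f /\
  charge_integral (cadd nu1 nu2) f =
    (charge_integral nu1 f + charge_integral nu2 f)%R.
Proof.
move=> [p1 n1] [p2 n2].
have [|i ->] := charge_integral_diff2 (nu := cadd nu1 nu2) p1 p2 n1 n2.
  move=> A mA; change (nu1 A + nu2 A + (
    jordan_neg (hahn_posneg nu1) A + jordan_neg (hahn_posneg nu2) A) =
    jordan_pos (hahn_posneg nu1) A + jordan_pos (hahn_posneg nu2) A).
  rewrite (chargeE (hahn_posneg nu1))// (chargeE (hahn_posneg nu2))//.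
  apply: addeCA_fin; exact: fin_num_measure.
by split=> //; rewrite /charge_integral; lra.
Qed.

End measures.

(** * Measures with a nonnegative integrable density *)

Section density.
Context (d : measure_display) (T : measurableType d) (R : realType).
Variables (m : {finite_measure set T -> \bar R}) (h : T -> \bar R).
Hypotheses (h_ge0 : forall x, (0 <= h x)%E) (hint : m.-integrable setT h).
Local Open Scope ereal_scope.

Fact integral_density_ge0 A : 0 <= induced_charge hint A.
Proof. exact: integral_ge0. Qed.

Definition density_measure := measure_of_charge _ integral_density_ge0.

HB.instance Definition _ := Measure.on density_measure.

Fact density_measure_fin : fin_num_fun density_measure.
Proof. by move=> A mA; exact: (@fin_num_measure _ _ _ (induced_charge hint)). Qed.

HB.instance Definition _ := @Measure_isFinite.Build _ _ _
  density_measure density_measure_fin.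

Lemma density_measureE A : density_measure A = \int[m]_(x in A) h x.
Proof. by []. Qed.

(** The density [h] and the Radon-Nikodym derivative of [density_measure] have the same integral
    over every measurable set, so they agree almost everywhere, and the change of variables for the
    derivative carries over to [h]. *)
Lemma ge0_integral_density_measure (f : T -> \bar R) :
  (forall x, 0 <= f x) -> measurable_fun setT f ->
  \int[density_measure]_x f x = \int[m]_x (f x * h x).
Proof.
move=> f_ge0 mf.
have dom : density_measure `<< m.
  apply/null_content_dominatesP => A mA A0.
  by rewrite density_measureE null_set_integral//; exact/measurable_funTS/measurable_int/hint.
have RNint := Radon_Nikodym_SigmaFinite.f_integrable dom.
rewrite -(Radon_Nikodym_SigmaFinite.change_of_variables dom)//.
have mh := measurable_int _ hint.
have mRN := measurable_int _ RNint.
apply: ge0_ae_eq_integral => //.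
- exact: emeasurable_funM.
- exact: emeasurable_funM.
- by move=> x _; rewrite mule_ge0// Radon_Nikodym_SigmaFinite.f_ge0.
- by move=> x _; rewrite mule_ge0.
apply: ae_eqe_mul2l.
apply: integral_ae_eq => // A _ mA.
by rewrite -Radon_Nikodym_SigmaFinite.f_integral.
Qed.

Let maxe_mul_ge0 (y z : \bar R) : 0 <= z -> maxe y 0 * z = maxe (y * z) 0.
Proof.
move=> z0; case: (leP 0 y) => [y0|/ltW y0].
  by rewrite [RHS]max_l// mule_ge0.
by rewrite mul0e max_r// mule_le0_ge0.
Qed.

(** Multiplication by [h >= 0] commutes with taking positive and negative parts, which reduces the
    claim to nonnegative functions. *)
Lemma integral_density_measure (f : T -> \bar R) :
  measurable_fun setT f -> m.-integrable setT (fun x => f x * h x) ->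
  density_measure.-integrable setT f /\
  \int[density_measure]_x f x = \int[m]_x (f x * h x).
Proof.
move=> mf fhint; split.
  apply/integrableP; split=> //.
  rewrite ge0_integral_density_measure//; last exact: measurableT_comp.
  have /integrableP[_] := fhint; congr (_ < _).
  by apply: eq_integral => x _; rewrite abseM (gee0_abs (h_ge0 x)).
rewrite integralE !ge0_integral_density_measure//;
  [|exact: measurable_funeneg|exact: measurable_funepos].
rewrite [RHS]integralE; congr (_ - _); apply: eq_integral => x _.
  by rewrite !funeposE maxe_mul_ge0.
by rewrite !funenegE -mulNe maxe_mul_ge0.
Qed.

End density.

(** * Integration against a charge with a density *)

Section charge_density_integral.
Context (d : measure_display) (T : measurableType d) (R : realType).

(** The positive and negative parts of [h] are densities of two measures whose difference is the
    induced charge, so [charge_integral_diff] applies to this pair. *)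
Lemma integral_induced_charge (m : {finite_measure set T -> \bar R}) (h f : T -> R)
    (hint : m.-integrable setT (EFin \o h)) :
  measurable_fun setT f -> m.-integrable setT (EFin \o (fun x => f x * h x)) ->
  charge_integrable (induced_charge hint) f /\
  charge_integral (induced_charge hint) f = \int[m]_x (f x * h x).
Proof.
move=> mf fhint.
have hpos := integrable_funepos measurableT hint.
have hneg := integrable_funeneg measurableT hint.
have mef : measurable_fun setT (EFin \o f) by exact/measurable_EFinP.
(* Both parts of [h] are bounded by [|h|], so integrability of [f h] passes to the two products. *)
have fhpos : m.-integrable setT (fun x => (EFin \o f) x * (EFin \o h)^\+ x)%E.
  apply: le_integrable fhint => //.
    by apply: emeasurable_funM => //; exact: measurable_int hpos.
  move=> x _; rewrite /= normrM EFinM abseM lee_wpmul2l//.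
  rewrite (gee0_abs (funepos_ge0 _ _)).
  by rewrite -[leRHS]/((abse \o (EFin \o h)) x) fune_abse/= leeDl.
have fhneg : m.-integrable setT (fun x => (EFin \o f) x * (EFin \o h)^\- x)%E.
  apply: le_integrable fhint => //.
    by apply: emeasurable_funM => //; exact: measurable_int hneg.
  move=> x _; rewrite /= normrM EFinM abseM lee_wpmul2l//.
  rewrite (gee0_abs (funeneg_ge0 _ _)).
  by rewrite -[leRHS]/((abse \o (EFin \o h)) x) fune_abse/= leeDr.
have [fp pE] := integral_density_measure (fun=> funepos_ge0 _ _) hpos mef fhpos.
have [fn nE] := integral_density_measure (fun=> funeneg_ge0 _ _) hneg mef fhneg.
have [|i ->] := @charge_integral_diff _ _ _ (induced_charge hint) _ _ f _ fp fn.
  move=> A mA.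
  rewrite /= /density_measure /measure_of_charge/= /induced_charge.
  have iA := integrableS measurableT mA (@subsetT _ A) hint.
  rewrite [in LHS]integralE subeK//; apply: integrable_fin_num => //.
  exact: integrable_funeneg.
split=> //.
rewrite /Rintegral.
rewrite [X in fine X - _]pE [X in _ - fine X]nE -fineB; [|exact: integrable_fin_num..].
congr fine; rewrite -integralB//; apply: eq_integral => x _ /=.
rewrite -muleBr ?add_def_funeposneg// EFinM; congr (_ * _)%E.
by rewrite -[RHS]/((EFin \o h) x) [in RHS](funeposneg (EFin \o h)).
Qed.

Lemma charge_integral_density (nu : {charge set T -> \bar R}) (h f : T -> R)
    (hint : charge_integrable nu h) :
  measurable_fun setT f -> charge_integrable nu (fun x => h x * f x) ->
  charge_integrable (charge_density hint) f /\
  charge_integral (charge_density hint) f = charge_integral nu (fun x => h x * f x).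
Proof.
move=> mf [hp hn].
have fhE : (fun x => f x * h x) = (fun x => h x * f x).
  by apply/funext => x; rewrite mulrC.
have [|pi pE] := integral_induced_charge hint.1 mf; first by rewrite fhE.
have [|ni nE] := integral_induced_charge hint.2 mf; first by rewrite fhE.
have [i E] := charge_integral_addN pi ni; split=> //.
rewrite fhE in pE nE.
by rewrite [LHS]E pE nE.
Qed.

Lemma charge_integralD (nu : {charge set T -> \bar R}) (f g : T -> R) :
  charge_integrable nu f -> charge_integrable nu g ->
  charge_integral nu (fun x => f x + g x) =
  charge_integral nu f + charge_integral nu g.
Proof.
by move=> [fp fn] [gp gn]; rewrite /charge_integral !RintegralD//; lra.
Qed.

Lemma charge_integralZ (nu : {charge set T -> \bar R}) (a : R) (f : T -> R) :
  charge_integrable nu f ->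
  charge_integral nu (fun x => a * f x) = a * charge_integral nu f.
Proof.
by move=> [fp fn]; rewrite /charge_integral !RintegralZl// mulrBr.
Qed.

Lemma charge_integral0 (nu : {charge set T -> \bar R}) :
  charge_integral nu (fun=> 0) = 0.
Proof.
rewrite -[RHS](mul0r (charge_integral nu (fun=> 0))).
rewrite -(charge_integralZ 0 (charge_integrable0 nu)).
by congr charge_integral; apply/funext => x; rewrite mul0r.
Qed.

End charge_density_integral.

(** * Complex measures and their moment functionals *)

Section complex_measures.
Variable R : realType.
Implicit Types (mu : complex_measure R) (f g : R -> R[i]) (u : R -> R).
Local Open Scope complex_scope.

Lemma cm_integralD mu f g : cm_integrable mu f -> cm_integrable mu g ->
  cm_integral mu (fun x => f x + g x) = cm_integral mu f + cm_integral mu g.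
Proof.
move=> [frr fri fir fii] [grr gri gir gii]; rewrite /cm_integral.
have reE : @complex.Re R \o (fun x => f x + g x) =
    (fun x => (@complex.Re R \o f) x + (@complex.Re R \o g) x).
  by apply/funext => x /=; case: (f x) (g x) => ? ? [].
have imE : @complex.Im R \o (fun x => f x + g x) =
    (fun x => (@complex.Im R \o f) x + (@complex.Im R \o g) x).
  by apply/funext => x /=; case: (f x) (g x) => ? ? [].
rewrite reE imE !charge_integralD//.
by apply/eqP; rewrite eq_complex/=; apply/andP; split; apply/eqP; ring.
Qed.

Lemma cm_integralZ mu (a : R[i]) f : cm_integrable mu f ->
  cm_integral mu (fun x => a * f x) = a * cm_integral mu f.
Proof.
move=> [rr ri ir ii]; rewrite /cm_integral.
have reE : @complex.Re R \o (fun x => a * f x) =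
    (fun x => complex.Re a * (@complex.Re R \o f) x +
              - complex.Im a * (@complex.Im R \o f) x).
  by apply/funext => x /=; rewrite mulNr; case: (a) (f x) => ? ? [].
have imE : @complex.Im R \o (fun x => a * f x) =
    (fun x => complex.Re a * (@complex.Im R \o f) x +
              complex.Im a * (@complex.Re R \o f) x).
  by apply/funext => x /=; case: (a) (f x) => ? ? [].
rewrite reE imE !charge_integralD//; do ?exact: charge_integrableZ.
rewrite !charge_integralZ//; case: a {reE imE} => a1 a2 /=.
by apply/eqP; rewrite eq_complex/=; apply/andP; split; apply/eqP; ring.
Qed.

(** A real test function has zero imaginary part, which removes the cross terms against the density;
    powers of the real variable are of this kind. *)
Lemma cm_integral_density mu f u (hf : cm_integrable mu f) :
  measurable_fun setT u -> cm_integrable mu (fun x => f x * (u x)%:C) ->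
  cm_integrable (cm_density hf) (fun x => (u x)%:C) /\
  cm_integral (cm_density hf) (fun x => (u x)%:C) =
    cm_integral mu (fun x => f x * (u x)%:C).
Proof.
move=> mu_ [].
have reE : @complex.Re R \o (fun x => f x * (u x)%:C) =
    (fun x => (@complex.Re R \o f) x * u x).
  by apply/funext => x /=; case: (f x) => a b /=; ring.
have imE : @complex.Im R \o (fun x => f x * (u x)%:C) =
    (fun x => (@complex.Im R \o f) x * u x).
  by apply/funext => x /=; case: (f x) => a b /=; ring.
rewrite /cm_integral reE imE.
case: hf => rr ri ir ii => urr uri uir uii.
have [irr Err] := charge_integral_density rr mu_ urr.
have [iri Eri] := charge_integral_density ri mu_ uri.
have [iir Eir] := charge_integral_density ir mu_ uir.
have [iii Eii] := charge_integral_density ii mu_ uii.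
have [re reE'] := charge_integral_addN irr iii.
have [im imE'] := charge_integral_add iri iir.
have uE : @complex.Re R \o (fun x => (u x)%:C) = u by [].
have u0 : @complex.Im R \o (fun x => (u x)%:C) = fun=> 0 by [].
rewrite /cm_integrable uE u0 !charge_integral0 subr0 add0r; split.
  by split=> //; exact: charge_integrable0.
by congr (_ +i* _); [rewrite [LHS]reE' Err Eii|rewrite [LHS]imE' Eri Eir].
Qed.

(** The proof [hmu] is an argument so that linearity, which rests on integrability, can be declared
    as a canonical instance. *)
Definition poly_functional mu (hmu : finite_moments mu) (p : {poly R[i]}) : R[i] :=
  cm_integral mu (fun x => p.[x%:C]).

Fact poly_functional_is_linear mu (hmu : finite_moments mu) :
  linear_for *%R (poly_functional hmu).
Proof.
move=> a p q; rewrite /poly_functional.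
rewrite -cm_integralZ; last exact: cm_integrable_horner.
rewrite -cm_integralD; [|apply: cm_integrableZ|]; try exact: cm_integrable_horner.
by congr cm_integral; apply/funext => x; rewrite hornerD hornerZ.
Qed.

HB.instance Definition _ mu (hmu : finite_moments mu) :=
  GRing.isLinear.Build R[i] {poly R[i]} R[i] *%R (poly_functional hmu)
    (poly_functional_is_linear hmu).

Lemma cm_integral_shift_pow mu z0 l (hmu : finite_moments mu) k :
  cm_integrable (shift_pow_measure z0 l hmu) (fun x => x%:C ^+ k) /\
  cm_integral (shift_pow_measure z0 l hmu) (fun x => x%:C ^+ k) =
    poly_functional hmu ('X^k * ('X - z0%:P) ^+ l).
Proof.
have powE : (fun x : R => x%:C ^+ k) = (fun x : R => (x ^+ k)%:C).
  by apply/funext => x; rewrite rmorphXn.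
have prodE : (fun x : R => ('X^k * ('X - z0%:P) ^+ l).[x%:C]) =
    (fun x : R => (x%:C - z0) ^+ l * (x ^+ k)%:C).
  apply/funext => x.
  by rewrite hornerM hornerXn horner_exp hornerXsubC mulrC rmorphXn.
rewrite powE /poly_functional prodE; apply: cm_integral_density.
  exact: measurable_funX.
by rewrite -prodE; exact: cm_integrable_horner.
Qed.

Lemma finite_moments_shift_pow mu z0 l (hmu : finite_moments mu) :
  finite_moments (shift_pow_measure z0 l hmu).
Proof. by move=> k; have [] := cm_integral_shift_pow z0 l hmu k. Qed.

(** Linearity reduces this to monomials. It trades the shifted measure for a polynomial factor,
    after which the argument is algebraic. *)
Lemma poly_functional_shift_pow mu z0 l (hmu : finite_moments mu)
    (hs : finite_moments (shift_pow_measure z0 l hmu)) p :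
  poly_functional hs p = poly_functional hmu (p * ('X - z0%:P) ^+ l).
Proof.
rewrite -[p]coefK poly_def mulr_suml !linear_sum; apply: eq_bigr => k _ /=.
rewrite -scalerAl !linearZ/=; congr (_ * _).
have [_ <-] := cm_integral_shift_pow z0 l hmu k.
by congr cm_integral; apply/funext => x; rewrite hornerXn.
Qed.

End complex_measures.

(** * Zeros of order [l] in terms of derivatives *)

Section root_multiplicity.
Variable F : numFieldType.
Implicit Types (p : {poly F}) (z : F).

(** One direction is the Taylor expansion at [z], factorials being nonzero in characteristic 0; in
    the other, differentiation lowers the power of ['X - z%:P] by at most one. *)
Lemma dvdp_XsubCXn_deriv p z l :
  (forall i, (i < l)%N -> p^`(i).[z] = 0) <-> ('X - z%:P) ^+ l %| p.
Proof.
split=> [pz|].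
  have -> : p = \sum_(i < size p) (p^`N(i).[z])%:P * ('X - z%:P) ^+ i.
    (* Taylor's formula is used over [{poly F}]: base point [z%:P] and increment ['X - z%:P] add up
       to ['X]. *)
    have := @nderiv_taylor _ (map_poly polyC p) z%:P ('X - z%:P) (mulrC _ _).
    rewrite addrCA subrr addr0 -[LHS]/(p \Po 'X) comp_polyXr => {1}->.
    rewrite size_map_polyC; apply: eq_bigr => i _.
    by rewrite nderivn_map horner_map.
  apply: (big_ind (fun q => ('X - z%:P) ^+ l %| q)) => [|q r|i _].
  - exact: dvdp0.
  - exact: dvdp_add.
  case: (ltnP i l) => [il|li]; last by rewrite dvdp_mull// dvdp_exp2l.
  have /eqP := pz i il; rewrite nderivn_def hornerMn mulrn_eq0 -leqn0 leqNgt.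
  by rewrite fact_gt0/= => /eqP ->; rewrite mul0r dvdp0.
elim: l p => // l IH p /dvdpP[q ->] [|i] il.
  by rewrite derivn0 exprSr mulrA hornerM hornerXsubC subrr mulr0.
rewrite derivSn; apply: IH => //.
rewrite derivM deriv_exp derivXsubC mul1r/= dvdp_add//.
  by rewrite dvdp_mull// exprS dvdp_mull.
by rewrite dvdp_mull// -mulr_natl dvdp_mull.
Qed.

End root_multiplicity.

(** * Orthogonality for linear functionals, and normality as unisolvence *)

Section orthogonality.
Variables (F : fieldType) (r : nat).
Implicit Types (L : 'I_r -> {scalar {poly F}}) (n : 'I_r -> nat) (p q : {poly F}).

Definition orthogonal L n p :=
  forall (i : 'I_r) k, (k < n i)%N -> L i (p * 'X^k) = 0.

Lemma orthogonalD L n p q :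
  orthogonal L n p -> orthogonal L n q -> orthogonal L n (p + q).
Proof. by move=> op oq i k kn; rewrite mulrDl linearD op ?oq ?addr0. Qed.

Lemma orthogonalZ L n a p : orthogonal L n p -> orthogonal L n (a *: p).
Proof. by move=> op i k kn; rewrite -scalerAl linearZ/= op ?mulr0. Qed.

Lemma orthogonal_sum L n (I : finType) (c : I -> F) (P : I -> {poly F}) :
  (forall s, orthogonal L n (P s)) -> orthogonal L n (\sum_s c s *: P s).
Proof.
move=> oP; apply: (big_ind (orthogonal L n)) => [|p q|s _].
- by move=> i k _; rewrite mul0r linear0.
- exact: orthogonalD.
- exact: orthogonalZ.
Qed.

(** The homogeneous form of normality: the square moment matrix has trivial kernel on coefficient
    vectors. *)
Definition unisolvent L n :=
  forall p, (size p <= mindex_norm n)%N -> orthogonal L n p -> p = 0.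

(** The orthogonality conditions are as many as the coefficients below the leading one, so
    injectivity of this square system gives solvability. *)
Lemma unisolvent_monic L n : unisolvent L n ->
  exists P, [/\ P \is monic, size P = (mindex_norm n).+1 & orthogonal L n P].
Proof.
move=> uL; set N := mindex_norm n.
(* [I] lists the conditions as pairs [(i, k)] with [k < n i]; its cardinal is [N]. *)
pose I := {i : 'I_r & 'I_(n i)}.
have cardI : #|{: I}| = N.
  rewrite card_tagged sumnE big_map big_enum/=.
  by apply: eq_bigr => i _; rewrite card_ord.
pose ev (e : 'I_#|{: I}|) : I := enum_val e.
pose M := \matrix_(q < N, e < #|{: I}|)
  L (tag (ev e)) ('X^q * 'X^(tagged (ev e))).
pose b := \row_(e < #|{: I}|) L (tag (ev e)) ('X^N * 'X^(tagged (ev e))).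
have LM (v : 'rV_N) e :
    L (tag (ev e)) (rVpoly v * 'X^(tagged (ev e))) = (v *m M) 0 e.
  rewrite [in LHS](row_sum_delta v) linear_sum mulr_suml linear_sum mxE.
  apply: eq_bigr => q _.
  by rewrite linearZ/= rVpoly_delta -scalerAl linearZ/= mxE.
have orthE p (B : 'rV_#|{: I}|) :
    (forall e, L (tag (ev e)) (p * 'X^(tagged (ev e))) = B 0 e) ->
    B = 0 -> orthogonal L n p.
  move=> pB B0 i k kn; pose t : I := Tagged _ (Ordinal kn).
  by have := pB (enum_rank t); rewrite /ev enum_rankK/= => ->; rewrite B0 mxE.
have Mfree : row_free M.
  rewrite -kermx_eq0; apply/eqP/row_matrixP => i; rewrite row0.
  apply: (can_inj (@rVpolyK _ _)); rewrite [RHS]linear0.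
  apply: uL; first exact: size_poly.
  apply: (orthE _ _ (LM _)).
  by apply/eqP; rewrite -sub_kermx row_sub.
have Mfull : row_full M by rewrite /row_full (eqP Mfree) cardI.
(* [v] holds the lower coefficients, chosen to cancel the contribution [b] of ['X^N]. *)
have /submxP[v vM] : (- b <= M)%MS by exact: submx_full.
have sizev : (size (rVpoly v) < size ('X^N : {poly F}))%N.
  by rewrite size_polyXn ltnS size_poly.
exists ('X^N + rVpoly v); split.
- by rewrite monicE lead_coefDl// lead_coefXn.
- by rewrite size_polyDl// size_polyXn.
apply: (orthE _ (b + v *m M)); last by rewrite -vM subrr.
by move=> e; rewrite mulrDl linearD LM !mxE.
Qed.

Lemma unisolventP L n :
  (exists! P, [/\ P \is monic, size P = (mindex_norm n).+1 & orthogonal L n P])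
  <-> unisolvent L n.
Proof.
split=> [[P [[Pm Ps Po] Pu]] p sp op|uL].
  have pP : (size p < size P)%N by rewrite Ps.
  (* [P + p] is again a monic solution of the same degree, so uniqueness gives [P + p = P]. *)
  apply: (addrI P); rewrite addr0; apply/esym/Pu; split.
  - by rewrite monicE lead_coefDl.
  - by rewrite size_polyDl.
  - exact: orthogonalD.
have [P [Pm Ps Po]] := unisolvent_monic uL.
exists P; split=> // Q [Qm Qs Qo].
apply/eqP; rewrite -subr_eq0; apply/eqP/uL.
  (* The leading terms of two monic polynomials of the same degree cancel in the difference. *)
  apply/leq_sizeP => j; rewrite leq_eqVlt coefB => /predU1P[<-|Nj].
    have := monicP Pm; have := monicP Qm.
    by rewrite /lead_coef Ps Qs => -> ->; rewrite subrr.
  by rewrite !nth_default ?Ps ?Qs// subrr.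
by apply: orthogonalD => //; rewrite -scaleN1r; exact: orthogonalZ.
Qed.

End orthogonality.

(** * Combinations of monic polynomials of consecutive degrees *)

Section staircase.
Variables (F : fieldType) (N l : nat) (P : 'I_l -> {poly F}).
Hypotheses (Pmonic : forall s, P s \is monic)
  (Psize : forall s, size (P s) = (N + s).+1).

Definition top_coef_mx : 'M[F]_l := \matrix_(s, t) (P s)`_(N + t).

(** The degrees [N + s] make the matrix lower triangular, with the leading coefficients, all 1, on
    the diagonal. *)
Lemma top_coef_mx_unit : top_coef_mx \in unitmx.
Proof.
rewrite unitmxE det_trig.
  rewrite big1 ?unitr1// => s _; rewrite mxE.
  by have := monicP (Pmonic s); rewrite /lead_coef Psize.
apply/is_trig_mxP => s t st; rewrite mxE nth_default// Psize.
by rewrite ltn_add2l.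
Qed.

Lemma coef_staircase_sum (c : 'rV_l) (t : 'I_l) :
  (\sum_s c 0 s *: P s)`_(N + t) = (c *m top_coef_mx) 0 t.
Proof. by rewrite coef_sum mxE; apply: eq_bigr => s _; rewrite coefZ mxE. Qed.

Lemma staircase_free (c : 'rV_l) : \sum_s c 0 s *: P s = 0 -> c = 0.
Proof.
move=> c0; rewrite -[c](mulmxK top_coef_mx_unit).
suff -> : c *m top_coef_mx = 0 by rewrite mul0mx.
by apply/rowP => t; rewrite -coef_staircase_sum c0 coef0 mxE.
Qed.

Lemma size_staircase_sum (c : 'rV_l) :
  (size (\sum_s c 0 s *: P s)%R <= N + l)%N.
Proof.
apply: (leq_trans (size_sum _ _ _)); apply/bigmax_leqP => s _.
by rewrite (leq_trans (size_scale_leq _ _))// Psize ltn_add2l.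
Qed.

Lemma staircase_span (p : {poly F}) : (size p <= N + l)%N ->
  exists c : 'rV_l, (size (p - \sum_s c 0 s *: P s)%R <= N)%N.
Proof.
(* This choice of [c] makes the combination match the coefficients of [p] in degrees [N] to
   [N + l - 1]. *)
move=> sp; exists ((\row_t p`_(N + t)) *m invmx top_coef_mx).
apply/leq_sizeP => j Nj; rewrite coefB; case: (ltnP j (N + l)) => jl.
  have jl' : (j - N < l)%N by rewrite ltn_subLR.
  have -> : j = (N + Ordinal jl')%N by rewrite /= subnKC.
  by rewrite coef_staircase_sum mulmxKV ?top_coef_mx_unit// mxE subrr.
rewrite !nth_default ?subrr ?(leq_trans sp)//.
exact: leq_trans (size_staircase_sum _) jl.
Qed.

End staircase.

(** * Singularity of the Wronskian matrix and failure of unisolvence *)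

Lemma wronskian_kernel (F : numFieldType) l (P : 'I_l -> {poly F}) z (c : 'rV_l) :
  c *m (\matrix_(i < l, k < l) ((P k)^`(i)).[z])^T = 0 <->
  ('X - z%:P) ^+ l %| \sum_s c 0 s *: P s.
Proof.
(* The transpose lets [c] weight the polynomials, so entry [i] is the [i]-th derivative of the
   combination at [z]. *)
have cW (i : 'I_l) : (c *m (\matrix_(i < l, k < l) ((P k)^`(i)).[z])^T) 0 i =
    (\sum_s c 0 s *: P s)^`(i).[z].
  rewrite mxE linear_sum horner_sum; apply: eq_bigr => s _.
  by rewrite !mxE linearZ hornerZ.
rewrite -dvdp_XsubCXn_deriv; split=> [c0 i il|c0].
  by rewrite -(cW (Ordinal il)) c0 mxE.
by apply/rowP => i; rewrite cW c0 ?mxE.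
Qed.

Lemma wronskian_eq0 (F : numFieldType) (r l : nat)
    (L L' : 'I_r -> {scalar {poly F}}) (n : 'I_r -> nat) (P : 'I_l -> {poly F}) z :
  (forall i p, L' i p = L i (p * ('X - z%:P) ^+ l)) ->
  unisolvent L n ->
  (forall s, P s \is monic) ->
  (forall s, size (P s) = (mindex_norm n + s).+1) ->
  (forall s, orthogonal L n (P s)) ->
  wronskian P z = 0 <-> ~ unisolvent L' n.
Proof.
move=> LL' uL Pm Ps Po.
have Xl0 : ('X - z%:P) ^+ l != 0 by rewrite expf_neq0// polyXsubC_eq0.
have orthE q : orthogonal L n (q * ('X - z%:P) ^+ l) <-> orthogonal L' n q.
  by split=> oq i k kn; have := oq i k kn; rewrite LL' mulrAC.
rewrite /wronskian -det_tr; split.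
  (* A nonzero kernel vector gives a combination divisible by the [l]-th power; the quotient [q]
     contradicts [uL']. *)
  move=> /eqP/det0P[c c0 /wronskian_kernel/dvdpP[q qE]] uL'.
  have q0 : q != 0.
    apply: contra_neq c0 => q0; apply: (staircase_free Pm Ps).
    by rewrite qE q0 mul0r.
  apply: (negP q0); apply/eqP/uL'; last first.
    by apply/orthE; rewrite -qE; exact: orthogonal_sum.
  (* Multiplying [q != 0] by the monic factor of degree [l] raises its size by exactly [l], so [q]
     has size at most [mindex_norm n]. *)
  have := size_staircase_sum Ps c.
  rewrite qE size_Mmonic ?monic_exp ?monicXsubC// size_exp_XsubC addnS/=.
  by rewrite leq_add2r.
apply: contra_notP => /eqP W0 q sq /orthE oq.
have [|c cs] := @staircase_span _ _ _ _ Pm Ps (q * ('X - z%:P) ^+ l).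
  rewrite (leq_trans (size_polyMleq _ _))// size_exp_XsubC addnS/=.
  by rewrite leq_add2r.
(* The remainder from [staircase_span] is short and orthogonal at [n], so [uL] makes it vanish. *)
have qE : q * ('X - z%:P) ^+ l = \sum_s c 0 s *: P s.
  apply/eqP; rewrite -subr_eq0; apply/eqP/uL => //.
  apply: orthogonalD => //; rewrite -scaleN1r; apply: orthogonalZ.
  exact: orthogonal_sum.
have /wronskian_kernel c0 : ('X - z%:P) ^+ l %| \sum_s c 0 s *: P s.
  by rewrite -qE dvdp_mull.
(* If [q] were nonzero, [c] would be a nonzero kernel vector, against [W0]. *)
apply/eqP; apply: contra_neqT W0 => q0; apply/eqP/det0P; exists c => //.
apply: contra_neq q0 => c00; apply/eqP.
have /eqP := qE; rewrite big1 ?mulf_eq0 ?(negPf Xl0) ?orbF// => s _.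
by rewrite c00 mxE scale0r.
Qed.

(** * Return to measures: normality through moment functionals, and the theorem *)

Section multiple_orthogonality.
Variables (R : realType) (r : nat) (mu : 'I_r -> complex_measure R).
Hypothesis hmu : forall i, finite_moments (mu i).

Definition moment_functionals (i : 'I_r) : {scalar {poly R[i]}} :=
  poly_functional (hmu i).

Lemma typeII_mopP n P : is_typeII_mop mu n P <->
  [/\ P \is monic, size P = (mindex_norm n).+1 &
      orthogonal moment_functionals n P].
Proof.
have LE i k : poly_functional (hmu i) (P * 'X^k) =
    cm_integral (mu i) (fun x => P.[(x%:C)%C] * (x%:C)%C ^+ k).
  by congr cm_integral; apply/funext => x; rewrite hornerM hornerXn.
by split=> -[Pm Ps Po]; split=> // i k kn; have := Po i k kn; rewrite -LE.
Qed.

Lemma normal_indexP n : normal_index mu n <-> unisolvent moment_functionals n.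
Proof.
rewrite -unisolventP; split=> -[P [/typeII_mopP PP Pu]]; exists P.
  by split=> // Q /typeII_mopP/Pu.
by split=> // Q /typeII_mopP/Pu.
Qed.

End multiple_orthogonality.

(** The first part supplies the consecutive degrees of the polynomials; the second makes
    orthogonality at a later index imply orthogonality at the first. *)
Lemma mindex_staircase (r l : nat) (hl : (0 < l)%N) (n : 'I_l -> 'I_r -> nat) :
  (forall s t : 'I_l, (t : nat) = s.+1 ->
     exists j : 'I_r, forall i : 'I_r, n t i = (n s i + (i == j))%N) ->
  forall s, mindex_norm (n s) = (mindex_norm (n (Ordinal hl)) + s)%N /\
            forall i, (n (Ordinal hl) i <= n s i)%N.
Proof.
move=> hstep [m]; elim: m => [|m IH] ml.
  by rewrite (_ : Ordinal ml = Ordinal hl) ?addn0//; exact: val_inj.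
have [Nm le_m] := IH (ltnW ml).
have [j nj] := hstep (Ordinal (ltnW ml)) (Ordinal ml) erefl.
split=> [|i]; last by rewrite nj (leq_trans (le_m i))// leq_addr.
rewrite /mindex_norm (eq_bigr _ (fun i _ => nj i)) big_split/=.
rewrite -/(mindex_norm _) Nm (bigD1 j)//= eqxx big1 => [|i /negPf-> //].
by rewrite addn0 addn1 addnS.
Qed.

Theorem theorem6p1 (R : realType) (r : nat) (hr : (0 < r)%N)
  (mu : 'I_r -> complex_measure R)
  (hmu : forall i : 'I_r, finite_moments (mu i))
  (l : nat) (hl : (0 < l)%N)
  (n : 'I_l -> 'I_r -> nat)
  (hstep : forall s t : 'I_l, (t : nat) = s.+1 ->
     exists j : 'I_r, forall i : 'I_r, n t i = (n s i + (i == j))%N)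
  (hnormal : forall s : 'I_l, normal_index mu (n s))
  (P : 'I_l -> {poly R[i]})
  (hP : forall s : 'I_l, is_typeII_mop mu (n s) (P s)) :
  [set z0 : R[i] | wronskian P z0 = 0] =
  [set z0 : R[i] |
     ~ normal_index (fun i => shift_pow_measure z0 l (hmu i))
         (n (Ordinal hl))].
Proof.
have staircase := mindex_staircase hl hstep.
have mopP s := proj1 (typeII_mopP hmu (n s) (P s)) (hP s).
have hshift z i := finite_moments_shift_pow z l (hmu i).
have W z : wronskian P z = 0 <->
    ~ unisolvent (moment_functionals (hshift z)) (n (Ordinal hl)).
  apply: (wronskian_eq0 (L := moment_functionals hmu)).
  - by move=> i p; exact: poly_functional_shift_pow.
  - exact/normal_indexP.
  - by move=> s; have [] := mopP s.
  - by move=> s; have [_ ->] := mopP s; have [->] := staircase s.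
  (* The conditions at the first index are among those at [n s], by the componentwise inequality. *)
  - move=> s i k kn; have [_ _] := mopP s; apply.
    by have [_ /(_ i)] := staircase s; exact: leq_trans.
apply/seteqP; split=> z /=; last by move=> nz; apply/W => /(normal_indexP (hshift z)).
by move=> /W nz /(normal_indexP (hshift z)).
Qed.
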